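(* Let $U\in M_n$ be a unitary matrix. Then the algebras $\Delta_n$ and $U\Delta_nU^*$ are quasiorthogonal if and only if $\sqrt{n}\,U$ is a complex Hadamard matrix.
   Context: $M_n$ is the algebra of $n\times n$ complex matrices, $\Delta_n\subseteq M_n$ is the algebra of complex diagonal matrices, and $U\Delta_nU^*=\{UDU^*: D\in\Delta_n\}$. Unital $*$-subalgebras $\mathcal{A},\mathcal{B}\subseteq M_n$ are quasiorthogonal if $\mathrm{Tr}(AB)=\frac{\mathrm{Tr}(A)\mathrm{Tr}(B)}{n}$ for all $A\in\mathcal{A}$, $B\in\mathcal{B}$. A complex Hadamard matrix is a matrix $H=[h_{i,j}]\in M_n$ with $|h_{i,j}|=1$ for all $1\le i,j\le n$ and $HH^*=nI_n$. *)

(* Defs.v *)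
From mathcomp Require Import all_boot all_order all_algebra.
From mathcomp Require Import classical_sets.

Set Implicit Arguments.
Unset Strict Implicit.
Unset Printing Implicit Defensive.

Import Order.TTheory GRing.Theory Num.Theory.

Local Open Scope classical_set_scope.
Local Open Scope ring_scope.
Local Open Scope sesquilinear_scope.

Record star_subalgebra (C : numClosedFieldType) (n : nat) := StarSubalgebra {
  star_subalgebra_set :> set 'M[C]_n;
  star_subalgebra1 : star_subalgebra_set 1%:M;
  star_subalgebraD : forall A B, star_subalgebra_set A ->
    star_subalgebra_set B -> star_subalgebra_set (A + B);
  star_subalgebraZ : forall (a : C) A,
    star_subalgebra_set A -> star_subalgebra_set (a *: A);
  star_subalgebraM : forall A B, star_subalgebra_set A ->
    star_subalgebra_set B -> star_subalgebra_set (A *m B);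
  star_subalgebra_adj : forall A,
    star_subalgebra_set A -> star_subalgebra_set (A ^t*) }.

Definition quasiorthogonal (C : numClosedFieldType) (n : nat)
    (SA SB : star_subalgebra C n) : Prop :=
  forall A B : 'M[C]_n,
    star_subalgebra_set SA A -> star_subalgebra_set SB B ->
    \tr (A *m B) = \tr A * \tr B / n%:R.

Definition complex_Hadamard (C : numClosedFieldType) (n : nat) (H : 'M[C]_n) : Prop :=
  (forall i j, `|H i j| = 1) /\ H *m H ^t* = n%:R *: 1%:M.

Section Subalgebras.
Variables (C : numClosedFieldType) (n : nat).
Implicit Types A B : 'M[C]_n.

Definition diag_set : set 'M[C]_n := [set D | is_diag_mx D].

Lemma diag_set1 : diag_set 1%:M.
Proof. exact: scalar_mx_is_diag. Qed.

Lemma diag_setD A B : diag_set A -> diag_set B -> diag_set (A + B).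
Proof.
move=> /is_diag_mxP dA /is_diag_mxP dB; apply/is_diag_mxP => i j ij.
by rewrite mxE dA // dB // addr0.
Qed.

Lemma diag_setZ (a : C) A : diag_set A -> diag_set (a *: A).
Proof.
move=> /is_diag_mxP dA; apply/is_diag_mxP => i j ij.
by rewrite mxE dA // mulr0.
Qed.

Lemma diag_setM A B : diag_set A -> diag_set B -> diag_set (A *m B).
Proof.
move=> /is_diag_mxP dA /is_diag_mxP dB; apply/is_diag_mxP => i j ij.
rewrite mxE big1 // => k _; have [ik|ik] := eqVneq i k.
  by rewrite dB ?mulr0 // -ik.
by rewrite dA ?mul0r.
Qed.

Lemma diag_set_adj A : diag_set A -> diag_set (A ^t*).
Proof.
move=> /is_diag_mxP dA; apply/is_diag_mxP => i j ij.
by rewrite !mxE dA ?rmorph0 // eq_sym.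
Qed.

Definition diag_algebra : star_subalgebra C n :=
  StarSubalgebra diag_set1 diag_setD diag_setZ diag_setM diag_set_adj.

Variables (U : 'M[C]_n) (hU : U \is unitarymx) (SA : star_subalgebra C n).

Definition conj_set : set 'M[C]_n := [set U *m A *m U ^t* | A in SA].

Lemma conj_set1 : conj_set 1%:M.
Proof.
exists 1%:M; first exact: star_subalgebra1.
by rewrite mulmx1; apply/unitarymxP.
Qed.

Lemma conj_setD A B : conj_set A -> conj_set B -> conj_set (A + B).
Proof.
move=> [A' hA <-] [B' hB <-]; exists (A' + B'); first exact: star_subalgebraD.
by rewrite mulmxDr mulmxDl.
Qed.

Lemma conj_setZ (a : C) A : conj_set A -> conj_set (a *: A).
Proof.
move=> [A' hA <-]; exists (a *: A'); first exact: star_subalgebraZ.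
by rewrite -scalemxAr -scalemxAl.
Qed.

Lemma conj_setM A B : conj_set A -> conj_set B -> conj_set (A *m B).
Proof.
move=> [A' hA <-] [B' hB <-]; exists (A' *m B'); first exact: star_subalgebraM.
by rewrite !mulmxA mulmxKtV.
Qed.

Lemma conj_set_adj A : conj_set A -> conj_set (A ^t*).
Proof.
move=> [A' hA <-]; exists (A' ^t*); first exact: star_subalgebra_adj.
by rewrite !trmx_mul !map_mxM /= trmxCK mulmxA.
Qed.

Definition conj_algebra : star_subalgebra C n :=
  StarSubalgebra conj_set1 conj_setD conj_setZ conj_setM conj_set_adj.

End Subalgebras.

Arguments diag_algebra : clear implicits.

(* Main.v *)
Require Import Defs.
From mathcomp Require Import all_boot all_order all_algebra.
From mathcomp Require Import classical_sets reals.
From mathcomp Require Import complex.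

(** For diagonal [A] and [D] one has
    [Tr (A U D U^* ) = \sum_(i, j) A_ii D_jj |U_ij|^2], so quasiorthogonality,
    tested on the diagonal matrix units, says that [|U_ij|^2 = 1/n] for all
    [i] and [j]; the relation [H H^* = n I] for [H = sqrt n U] is automatic. *)

Import Order.TTheory GRing.Theory Num.Theory.
Local Open Scope ring_scope.

Section Quasiorthogonality.
Local Open Scope sesquilinear_scope.
Variables (C : numClosedFieldType) (n : nat).
Implicit Types A D U : 'M[C]_n.

Lemma mxtrace_diag_conj A D U : is_diag_mx A -> is_diag_mx D ->
  \tr (A *m (U *m D *m U ^t*)) =
  \sum_i \sum_j A i i * D j j * `|U i j| ^+ 2.
Proof.
move=> /is_diag_mxP dA /is_diag_mxP dD; apply: eq_bigr => i _.
(* Diagonality of [A] leaves only [k = i] in the outer product; that of [D] then collapses the inner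
   one, leaving [U i j] times its conjugate. *)
rewrite mxE (bigD1 i) //= big1 ?addr0 => [|k ki]; last first.
  by rewrite dA ?mul0r // eq_sym.
rewrite mxE mulr_sumr; apply: eq_bigr => j _.
rewrite mxE (bigD1 j) //= big1 ?addr0 => [|k kj]; last by rewrite dD ?mulr0.
by rewrite !mxE normCK -!mulrA [U i j * _]mulrCA.
Qed.

Lemma mxtrace_unitary_conj U D :
  U \is unitarymx -> \tr (U *m D *m U ^t*) = \tr D.
Proof.
(* For square matrices a right inverse is a left inverse, so cyclicity of the trace cancels [U ^t*]
   against [U]. *)
by move=> /unitarymxP/mulmx1C UU1; rewrite mxtrace_mulC mulmxA UU1 mul1mx.
Qed.

Lemma delta_mx_is_diag (i : 'I_n) : is_diag_mx (delta_mx i i : 'M[C]_n).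
Proof.
apply/is_diag_mxP => k l kl; rewrite mxE.
by have [ki|//] := eqVneq k i; rewrite -ki -val_eqE eq_sym (negPf kl).
Qed.

Lemma mxtrace_delta (i : 'I_n) : \tr (delta_mx i i : 'M[C]_n) = 1.
Proof.
rewrite /mxtrace (bigD1 i) //= big1 => [|k /negPf ki]; last by rewrite mxE ki.
by rewrite mxE eqxx addr0.
Qed.

Lemma quasiorthogonal_diag_conjP U (hU : U \is unitarymx) :
  quasiorthogonal (diag_algebra C n) (conj_algebra hU (diag_algebra C n)) <->
  forall i j, `|U i j| ^+ 2 = n%:R^-1.
Proof.
split=> [qU i j | hn A _ dA [D dD <-]].
  have dj : conj_set U (diag_algebra C n) (U *m delta_mx j j *m U ^t*).
    by exists (delta_mx j j); first exact: delta_mx_is_diag.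
  (* Both test matrices have trace 1, so the right-hand side is [n%:R^-1]; on the left only the term
     [(i, j)] of the double sum survives. *)
  have := qU _ _ (delta_mx_is_diag i) dj.
  rewrite mxtrace_unitary_conj // !mxtrace_delta !mul1r.
  rewrite mxtrace_diag_conj ?delta_mx_is_diag // (bigD1 i) //= (bigD1 j) //=.
  rewrite !mxE !eqxx !mul1r big1 => [|k /negPf kj]; last first.
    by rewrite !mxE kj mulr0 mul0r.
  rewrite big1 ?addr0 // => k /negPf ki.
  by rewrite big1 // => l _; rewrite !mxE ki !mul0r.
(* Conversely, with the constant weight [n%:R^-1] the double sum factors into the product of the two
   traces. *)
rewrite mxtrace_unitary_conj // mxtrace_diag_conj // /mxtrace !mulr_suml.
apply: eq_bigr => i _; rewrite mulr_sumr mulr_suml.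
by apply: eq_bigr => j _; rewrite hn.
Qed.

Lemma complex_Hadamard_unitaryP U (n_gt0 : (0 < n)%N) : U \is unitarymx ->
  complex_Hadamard (sqrtC n%:R *: U) <->
  forall i j, `|U i j| ^+ 2 = n%:R^-1.
Proof.
move=> /unitarymxP UU1.
have n_neq0 : n%:R != 0 :> C by rewrite pnatr_eq0 -lt0n.
have sqrt_ge0 : 0 <= sqrtC n%:R :> C by rewrite sqrtC_ge0 ler0n.
have norm2 i j : `|(sqrtC n%:R *: U) i j| ^+ 2 = n%:R * `|U i j| ^+ 2.
  by rewrite mxE normrM exprMn ger0_norm // sqrtCK.
split=> [[H1 _] i j | hn].
  by apply: (mulfI n_neq0); rewrite -norm2 H1 expr1n divff.
split=> [i j|].
  (* A nonnegative number is 1 as soon as its square is. *)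
  by apply/eqP; rewrite -sqrp_eq1 ?normr_ge0 // norm2 hn divff.
(* The scalar [sqrtC n%:R] is nonnegative, hence fixed by conjugation, so the two scalars pulled out
   multiply to [n%:R]. *)
rewrite linearZ /= map_mxZ -scalemxAl -scalemxAr UU1 scalerA.
by rewrite /= geC0_conj // -expr2 sqrtCK.
Qed.

End Quasiorthogonality.

Theorem proposition2p2 (R : realType) (n : nat) (hn : (0 < n)%N)
    (U : 'M[R[i]]_n) (hU : U \is unitarymx) :
  quasiorthogonal (diag_algebra R[i] n) (conj_algebra hU (diag_algebra R[i] n)) <->
  complex_Hadamard (sqrtC (n%:R : R[i]) *: U).
Proof.
apply: (iff_trans (quasiorthogonal_diag_conjP _ _ U hU)).
by apply: iff_sym; apply: complex_Hadamard_unitaryP.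
Qed.
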